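(* Let $P$ be a finite poset with an $n$-dimensional lattice projection $\pi$. Let $v=(v_1,\dots,v_n)$ and $w=(w_1,\dots,w_n)$, where $v_j,w_j\in\{\pm1\}$. Suppose that $\sigma:\mathrm{supp}(P,\pi,v)\to\mathrm{supp}(P,\pi,v)$ and $\tau:\mathrm{supp}(P,\pi,w)\to\mathrm{supp}(P,\pi,w)$ are bijections. Then there is an equivariant bijection between $J(P)$ under $\mathrm{Pro}_{\pi,v}^{\sigma}$ and $J(P)$ under $\mathrm{Pro}_{\pi,w}^{\tau}$; that is, there is a bijection $\varphi:J(P)\to J(P)$ with $\varphi\circ\mathrm{Pro}_{\pi,v}^{\sigma}=\mathrm{Pro}_{\pi,w}^{\tau}\circ\varphi$.
   Context: **Order ideals and toggles.** $J(P)$ is the set of order ideals (downward closed subsets) of $P$. For $e\in P$ the toggle $t_e:J(P)\to J(P)$ sends $I$ to $I\cup\{e\}$ if $e\notin I$ and $I\cup\{e\}\in J(P)$, to $I\setminus\{e\}$ if $e\in I$ and $I\setminus\{e\}\in J(P)$, and to $I$ otherwise. Toggles $t_e,t_f$ commute if neither of $e,f$ covers the other. **Lattice projections.** A poset $P$ is ranked if it admits a function $\mathrm{rk}:P\to\mathbb Z$ with $\mathrm{rk}(y)=\mathrm{rk}(x)+1$ whenever $y$ covers $x$. An $n$-dimensional lattice projection of a ranked poset $P$ is an order-preserving and rank-preserving map $\pi:P\to\mathbb Z^n$, where $\mathbb Z^n$ has the componentwise order and rank function the sum of the coordinates. (In particular, if $y$ covers $x$ in $P$ then $\pi(y)$ covers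 $\pi(x)$, i.e. $\pi(y)-\pi(x)$ is a standard basis vector.) **Hyperplane toggles.** For $v\in\{\pm1\}^n$ and $i\in\mathbb Z$, $T_{\pi,v}^i$ is the product of the toggles $t_x$ over all $x\in P$ with $\langle\pi(x),v\rangle=i$ (the identity if there are none); these toggles commute, so the product is well defined. The support $\mathrm{supp}(P,\pi,v)$ is the smallest interval $[a,b]$ of integers such that $T_{\pi,v}^i$ is the identity for all $i\in\mathbb Z\setminus[a,b]$; it is finite since $P$ is finite. For a bijection $\sigma:[a,b]\to[a,b]$, where $[a,b]=\mathrm{supp}(P,\pi,v)$, define $$\mathrm{Pro}_{\pi,v}^{\sigma}=T_{\pi,v}^{\sigma(a)}T_{\pi,v}^{\sigma(a+1)}\cdots T_{\pi,v}^{\sigma(b-1)}T_{\pi,v}^{\sigma(b)},$$ a composition of permutations of $J(P)$. *)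

(* Defs.v *)
From mathcomp Require Import all_boot all_order all_algebra.
From mathcomp Require Import zify.

Set Implicit Arguments.
Unset Strict Implicit.
Unset Printing Implicit Defensive.

Import Order.TTheory GRing.Theory Num.Theory.
Local Open Scope ring_scope.

Section Posets.
Context {d : Order.disp_t} {P : finPOrderType d}.

Definition covers (x y : P) : Prop :=
  (x < y)%O /\ forall z : P, ~ ((x < z)%O /\ (z < y)%O).

Definition rank_function (rk : P -> int) : Prop :=
  forall x y : P, covers x y -> rk y = rk x + 1.

Definition is_order_ideal (I : {set P}) : bool :=
  [forall x in I, forall y, (y <= x)%O ==> (y \in I)].

Definition order_ideal : Type := {I : {set P} | is_order_ideal I}.

(* [insubd I A] is the order ideal with underlying set [A] if [A] is an order
   ideal, and [I] otherwise. *)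
Definition toggle (e : P) (I : order_ideal) : order_ideal :=
  if e \in val I then insubd I (val I :\ e) else insubd I (e |: val I).

(* Z^n carries the componentwise order and is ranked by the coordinate sum. *)
Definition lattice_projection (n : nat) (rk : P -> int) (pi : P -> 'rV[int]_n)
    : Prop :=
  (forall x y : P, (x <= y)%O -> forall j, pi x 0 j <= pi y 0 j) /\
  (forall x : P, \sum_j pi x 0 j = rk x).

Definition sign_vector (n : nat) (v : 'rV[int]_n) : Prop :=
  forall j, v 0 j = 1 \/ v 0 j = -1.

Definition dotp (n : nat) (u v : 'rV[int]_n) : int := \sum_j u 0 j * v 0 j.

(* The factors are composed in the order of the enumeration of [P]; when [pi]
   is a lattice projection and [v] a sign vector they commute pairwise. *)
Definition hyperplane_toggle (n : nat) (pi : P -> 'rV[int]_n) (v : 'rV[int]_n)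
    (i : int) : order_ideal -> order_ideal :=
  \big[comp/id]_(x : P | dotp (pi x) v == i) toggle x.

Definition trivial_outside (n : nat) (pi : P -> 'rV[int]_n) (v : 'rV[int]_n)
    (a b : int) : Prop :=
  forall i : int, i \notin `[a, b] -> hyperplane_toggle pi v i =1 id.

(* [a, b] = supp(P, pi, v).  The interval is empty (b < a) exactly when
   every hyperplane toggle is the identity, e.g. when P is empty. *)
Definition is_supp (n : nat) (pi : P -> 'rV[int]_n) (v : 'rV[int]_n)
    (a b : int) : Prop :=
  trivial_outside pi v a b /\
  forall a' b' : int,
    trivial_outside pi v a' b' -> {subset `[a, b] <= `[a', b']}.

(* a, a + 1, ..., b, in this order *)
Definition int_range (a b : int) : seq int :=
  if a <= b then [seq a + k%:Z | k <- iota 0 `|b - a|%N.+1] else [::].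

(* T^(sigma a) \o T^(sigma (a + 1)) \o ... \o T^(sigma b) *)
Definition Pro (n : nat) (pi : P -> 'rV[int]_n) (v : 'rV[int]_n) (a b : int)
    (sigma : int -> int) : order_ideal -> order_ideal :=
  \big[comp/id]_(i <- int_range a b) hyperplane_toggle pi v (sigma i).

End Posets.

Arguments order_ideal {d} P.

(* [sigma] restricts to a bijection of [a, b] onto itself; its values elsewhere
   are irrelevant. *)
Definition interval_bijection (a b : int) (sigma : int -> int) : Prop :=
  [/\ forall i, i \in `[a, b] -> sigma i \in `[a, b],
      {in `[a, b] &, injective sigma}
    & forall j, j \in `[a, b] -> exists2 i, i \in `[a, b] & sigma i = j].

Lemma mem_int_range (a b i : int) : (i \in int_range a b) = (i \in `[a, b]).
Proof.
have -> : (i \in `[a, b]) = (a <= i <= b) by rewrite in_itv.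
rewrite /int_range; case: ifP => [ab|/negbT nab]; last first.
  by rewrite in_nil; apply/esym/negbTE; lia.
apply/mapP/andP => [[k]|[ai ib]].
  by rewrite mem_iota => /andP[_ kb] ->; split; lia.
by exists `|i - a|%N; [rewrite mem_iota; lia | lia].
Qed.

Lemma hull_exists (s : seq int) :
  exists a b : int, {subset s <= `[a, b]} /\
    forall a' b' : int, {subset s <= `[a', b']} -> {subset `[a, b] <= `[a', b']}.
Proof.
suff [->|[a [b [sa sb sab]]]] : s = [::] \/
    exists a b : int, [/\ a \in s, b \in s & {subset s <= `[a, b]}].
- by exists 1, 0; split=> // a' b' _ i; rewrite in_itv /=; lia.
- exists a, b; split=> // a' b' h i.
  move: (h _ sa) (h _ sb); rewrite !in_itv /=; lia.
elim: s => [|x s IH]; [by left | right].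
case: IH => [->|[a [b [sa sb sab]]]].
  by exists x, x; rewrite !inE; split=> // i; rewrite inE in_itv => /eqP->/=; lia.
exists (Num.min a x), (Num.max b x); split.
- by case: leP => _; rewrite inE ?sa ?eqxx ?orbT.
- by case: leP => _; rewrite inE ?sb ?eqxx ?orbT.
move=> i; rewrite inE => /orP[/eqP->|/sab]; rewrite !in_itv /=; lia.
Qed.

Lemma supp_exists (d : Order.disp_t) (P : finPOrderType d) (n : nat)
    (pi : P -> 'rV[int]_n) (v : 'rV[int]_n) : exists a b, is_supp pi v a b.
Proof.
pose nt i := [exists I, hyperplane_toggle pi v i I != I].
pose s := [seq i <- [seq dotp (pi x) v | x : P] | nt i].
have sP a b : {subset s <= `[a, b]} <-> trivial_outside pi v a b.
  split=> [h i iab I|h i].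
    apply/eqP; apply: contraNT iab => TI; apply: h.
    rewrite mem_filter; apply/andP; split; first by apply/existsP; exists I.
    apply: contraNT TI => /imageP nx.
    rewrite /hyperplane_toggle big_pred0 // => x.
    by apply/negbTE/eqP => xi; apply: nx; exists x.
  rewrite mem_filter => /andP[/existsP[I TI] _].
  by apply: contraNT TI => /h ->.
have [a [b [/sP h1 h2]]] := hull_exists s.
by exists a, b; split=> // a' b' /sP; apply: h2.
Qed.

(* Main.v *)
Require Import Defs.
From mathcomp Require Import all_boot all_order all_algebra.
From mathcomp Require Import zify.
From mathcomp Require Import zify.

(** The idea is that every promotion is conjugate to one and the same map,
    gyration: toggle all the elements of odd rank, then all those of even rank.

    The elements of a cover have images that differ by a standard basis vector,
    so that their heights [dotp (pi x) v] differ by at most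
    one ([covers_dotp]).  Hence hyperplane toggles at heights that differ by more
    than one commute, and the [T^i] behave like the generators of a Coxeter
    group of type A.  As for the Coxeter elements of a path, all the products
    of the [T^i], each taken once, are conjugate, whatever the order: by
    commutations and rotations, which conjugate the product, every word without
    repetition can be sorted ([perm_cyc]).  In particular [Pro] is conjugate to
    the product of the [T^i] with [i] even followed by that with [i] odd.

    All the entries of [v] are odd, so the height of [x] has the same parity as
    the rank of [x] ([even_dotp]).  The product of the [T^i] over even [i] is
    therefore the product of all toggles at elements of even rank.  These
    commute, since the ranks in a cover have opposite parities, so their
    product does not depend on an order, and hence not on [v]. *)

Set Implicit Arguments.
Unset Strict Implicit.
Unset Printing Implicit Defensive.

Import Order.TTheory GRing.Theory Num.Theory.
Local Open Scope ring_scope.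

(** * Conjugate maps *)

Section Conjugate.
Variable X : Type.
Implicit Types f g h : X -> X.

Definition conjugate f g : Prop :=
  exists phi : X -> X, bijective phi /\ phi \o f =1 g \o phi.

Lemma eq_conjugate f g : f =1 g -> conjugate f g.
Proof. by move=> fg; exists id; split; [exists id | move=> x /=]. Qed.

Lemma conjugate_sym f g : conjugate f g -> conjugate g f.
Proof.
case=> phi [[psi phiK psiK] fg]; exists psi; split; first by exists phi.
by move=> x /=; rewrite -{1}[x]psiK -[g _]fg /= phiK.
Qed.

Lemma conjugate_trans f g h : conjugate f g -> conjugate g h -> conjugate f h.
Proof.
case=> phi [bphi fg] [psi [bpsi gh]]; exists (psi \o phi).
split; first exact: bij_comp.
by move=> x /=; rewrite [phi _]fg [psi _]gh.
Qed.

End Conjugate.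

(** * Products of maps along a word *)

Section Words.
Variables (A X : Type) (f : A -> X -> X).

Definition act (s : seq A) (x : X) : X := foldr f x s.

Lemma big_comp_act (s : seq A) : \big[comp/id]_(i <- s) f i =1 act s.
Proof.
by move=> x; elim: s => [|i s IH]; rewrite ?big_nil // big_cons /= IH.
Qed.

Lemma act_cat (s t : seq A) x : act (s ++ t) x = act s (act t x).
Proof. exact: foldr_cat. Qed.

Lemma act_bij (s : seq A) : (forall i, bijective (f i)) -> bijective (act s).
Proof.
move=> bf; elim: s => [|i s IH]; first by exists id.
exact: (bij_comp (bf i) IH).
Qed.

End Words.

Lemma act_flatten (A B X : Type) (f : A -> X -> X) (block : B -> seq A) s :
  act (fun i => act f (block i)) s =1 act f (flatten [seq block i | i <- s]).
Proof. by move=> x; elim: s => //= i s ->; rewrite act_cat. Qed.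

Lemma eq_act (A X : Type) (f g : A -> X -> X) s :
  (forall i, f i =1 g i) -> act f s =1 act g s.
Proof. by move=> fg x; elim: s => //= i s ->; rewrite fg. Qed.

Lemma act_perm (A : eqType) (X : Type) (f : A -> X -> X) (s t : seq A) :
    {in s &, forall i j x, f i (f j x) = f j (f i x)} ->
  perm_eq s t -> act f s =1 act f t.
Proof.
elim: s t => [|i s IH] t fC st x.
  by rewrite perm_sym in st; move/perm_nilP: st => ->.
have it : i \in t by rewrite -(perm_mem st) mem_head.
case/splitPr: it st => t1 t2 st.
have st' : perm_eq s (t1 ++ t2).
  by rewrite -(perm_cons i) (permPl st) perm_catC /= perm_cons perm_catC.
have {}IH : act f s =1 act f (t1 ++ t2).
  by apply: IH => // j k js ks; apply: fC; rewrite inE ?js ?ks orbT.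
rewrite /= -/(act f s x) IH !act_cat /=; move: (act f t2 x) => y.
have : {subset t1 <= s}.
  by move=> j jt; rewrite (perm_mem st') mem_cat jt.
elim: t1 {st st' IH} => //= j t1 IH sub.
rewrite -IH; last by move=> k kt; apply: sub; rewrite inE kt orbT.
by apply: fC; rewrite inE ?eqxx // sub ?mem_head ?orbT.
Qed.

(** * Coxeter elements of a path *)

Definition far (i j : int) : bool := 1 < `|i - j|.

(** The equivalence of words generated by the two moves that preserve the
    conjugacy class of a product when distant letters commute.  Since rotations
    are available, it suffices to commute the first two letters. *)
Inductive cyc : seq int -> seq int -> Prop :=
| CycRefl s : cyc s s
| CycSym s t : cyc s t -> cyc t s
| CycTrans t s u : cyc s t -> cyc t u -> cyc s u
| CycRot i s : cyc (rcons s i) (i :: s)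
| CycSwap i j s : far i j -> cyc (i :: j :: s) (j :: i :: s).

Lemma cyc_perm s t : cyc s t -> perm_eq s t.
Proof.
elim=> {s t} [s|s t _ st|t s u _ st _ tu|i s|i j s _] //.
- by rewrite perm_sym.
- exact: perm_trans tu.
- by rewrite perm_rcons.
- by rewrite (perm_catCA [:: i] [:: j]).
Qed.

Lemma cyc_catC s t : cyc (s ++ t) (t ++ s).
Proof.
elim: s t => [|i s IH] t; first by rewrite cats0; apply: CycRefl.
apply: (CycTrans (CycSym (CycRot _ _))).
by rewrite rcons_cat -cat_rcons; apply: IH.
Qed.

Lemma cyc_far i s t : all (far i) s -> cyc (i :: s ++ t) (s ++ i :: t).
Proof.
elim: s t => [|j s IH] t /=; first by move=> _; apply: CycRefl.
case/andP=> ij is_; apply: (CycTrans (CycSwap _ ij)).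
(* [j] is moved to the end so as to uncover [i]. *)
apply: (CycTrans (CycSym (CycRot _ _))).
rewrite rcons_cons rcons_cat; apply: (CycTrans (IH _ is_)).
by rewrite -rcons_cons -rcons_cat; apply: CycRot.
Qed.

(** The new letter [m] is an end of the path, so its only neighbour is [m + 1].
    When [m + 1] is the letter rotated in [s], it cannot pass [m]; but then [m]
    commutes with all the other letters and can go around the other way. *)
Lemma cyc_cons m s t :
  uniq s -> all (> m) s -> cyc s t -> cyc (m :: s) (m :: t).
Proof.
move=> us ms st; elim: st us ms => {s t}
  [s|s t st IH|t s u st IHst tu IHtu|i s|i j s ij] us ms.
- exact: CycRefl.
- apply: CycSym; apply: IH.
    by rewrite (perm_uniq (cyc_perm st)).
  by rewrite (perm_all _ (cyc_perm st)).
- apply: (CycTrans (IHst us ms)); apply: IHtu.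
    by rewrite -(perm_uniq (cyc_perm st)).
  by rewrite -(perm_all _ (cyc_perm st)).
- move: us ms; rewrite rcons_uniq all_rcons => /andP[is_ us] /andP[mi ms].
  have [mi1|mi1] := boolP (far m i).
    rewrite -rcons_cons; apply: (CycTrans (CycRot _ _)).
    by apply: CycSwap; move: mi1; rewrite /far distrC.
  have far_s : all (far m) s.
    apply/allP=> j js; have := allP ms _ js.
    have : j != i by apply: contraNneq is_ => <-.
    by move: mi mi1; rewrite /far; lia.
  rewrite -cats1; apply: (CycTrans (cyc_far _ far_s)).
  by rewrite -cat1s catA; apply: (CycTrans (cyc_catC _ _)); rewrite /= cats1;
    apply: (CycRot m (i :: s)).
- apply: (CycTrans (CycSym (CycRot _ _))); rewrite !rcons_cons.
  by apply: (CycTrans (CycSwap _ ij)); rewrite -!rcons_cons; apply: CycRot.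
Qed.

(** Insertion sort: the least letter is rotated to the front, and the moves that
    sort the others can be carried out behind it. *)
Lemma cyc_sorted s r : sorted <%O r -> perm_eq s r -> cyc s r.
Proof.
elim: r s => [|m r IH] s; first by move=> _ /perm_nilP->; apply: CycRefl.
move=> mr sr; have ms : m \in s by rewrite (perm_mem sr) mem_head.
case/splitPr: ms sr => s1 s2 sr; apply: (CycTrans (cyc_catC _ _)) => /=.
have s21r : perm_eq (s2 ++ s1) r.
  by rewrite -(perm_cons m) -(permPr sr) perm_sym perm_catC.
have ur : uniq r by move: (lt_sorted_uniq mr) => /andP[].
apply: cyc_cons; last by apply: IH => //; apply: path_sorted mr.
  by rewrite (perm_uniq s21r).
by rewrite (perm_all _ s21r); apply: order_path_min mr; apply: lt_trans.
Qed.

Lemma perm_cyc s t : uniq s -> perm_eq s t -> cyc s t.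
Proof.
move=> us st; have ss : sorted <%O (sort <=%O s) by rewrite sort_lt_sorted.
apply: CycTrans (CycSym (cyc_sorted ss _)); last by rewrite perm_sym perm_sort.
by apply: cyc_sorted => //; rewrite perm_sym perm_sort.
Qed.

Section PathProducts.
Variables (X : Type) (T : int -> X -> X).
Hypothesis T_bij : forall i, bijective (T i).
Hypothesis T_far : forall i j x, far i j -> T i (T j x) = T j (T i x).

Lemma cyc_conjugate s t : cyc s t -> conjugate (act T s) (act T t).
Proof.
elim=> {s t} [s|s t _|t s u _ st _|i s|i j s ij].
- exact: eq_conjugate.
- exact: conjugate_sym.
- exact: conjugate_trans.
- exists (T i); split; first exact: T_bij.
  by move=> x /=; rewrite -cats1 act_cat.
- by apply: eq_conjugate => x /=; rewrite T_far.
Qed.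

End PathProducts.

(** * Toggles *)

Section Toggles.
Context {d : Order.disp_t} {P : finPOrderType d}.
Implicit Types (I J : order_ideal P) (e f x y z : P).

Lemma ideal_le I x y : (y <= x)%O -> x \in val I -> y \in val I.
Proof.
by move=> yx xI; have /forall_inP/(_ x xI)/forallP/(_ y)/implyP/(_ yx) := valP I.
Qed.

Lemma mem_toggle e I x : (x \in val (toggle e I)) =
  if x != e then x \in val I
  else if e \in val I then [exists y in val I, (e < y)%O]
  else [forall y, (y < e)%O ==> (y \in val I)].
Proof.
rewrite /toggle; case: ifP => eI; rewrite val_insubd.
  have -> : is_order_ideal (val I :\ e) = ~~ [exists y in val I, (e < y)%O].
    apply/idP/existsPn => [ideal y|noy].
      apply/andP=> -[yI ey].
      have yIe : y \in val I :\ e by rewrite !inE yI gt_eqF.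
      move/forall_inP/(_ y yIe)/forallP/(_ e)/implyP/(_ (ltW ey)): ideal.
      by rewrite !inE eqxx.
    apply/forall_inP=> y; rewrite !inE => /andP[ye yI].
    apply/forallP=> z; apply/implyP=> zy; rewrite !inE (ideal_le zy yI) andbT.
    apply/eqP=> ze; have /negP[] := noy y; rewrite yI lt_neqAle eq_sym ye.
    by rewrite -ze.
  case: ifPn => [/negbTE -> | /negPn ->]; first by rewrite !inE; case: eqP.
  by case: eqP => // ->; rewrite eI.
have -> : is_order_ideal (e |: val I) = [forall y, (y < e)%O ==> (y \in val I)].
  apply/idP/forallP => [ideal y|ally].
    apply/implyP=> ye.
    move/forall_inP/(_ e (setU11 _ _))/forallP/(_ y)/implyP/(_ (ltW ye)): ideal.
    by rewrite !inE lt_eqF.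
  apply/forall_inP=> y; rewrite !inE => yI.
  apply/forallP=> z; apply/implyP=> zy; rewrite !inE.
  case/orP: yI => [/eqP ye|yI]; last by rewrite (ideal_le zy yI) orbT.
  move: zy; rewrite ye le_eqVlt => /orP[->//|/(implyP (ally z)) ->].
  exact: orbT.
case: ifPn => _; first by rewrite !inE; case: eqP.
by case: eqP => // ->.
Qed.

Lemma ideal_eqP I J : val I =i val J -> I = J.
Proof. by move=> IJ; apply/val_inj/setP. Qed.

Lemma toggleK e : involutive (toggle e).
Proof.
move=> I; apply: ideal_eqP => x; rewrite !mem_toggle eqxx /=.
case: eqP => //= ->; have [eI|eI] := boolP (e \in val I); case: ifPn => //.
- case/exists_inP=> y yI ey; apply/exists_inP; exists y => //.
  by rewrite mem_toggle gt_eqF.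
- move=> _; apply/forallP=> y; apply/implyP=> ye.
  by rewrite mem_toggle lt_eqF // (ideal_le (ltW ye) eI).
- move=> _; apply/negbTE/exists_inP => -[y yI ey]; move: yI.
  rewrite mem_toggle gt_eqF //= => yI.
  by rewrite (ideal_le (ltW ey) yI) in eI.
- case/forallPn=> y; rewrite negb_imply => /andP[ye yI].
  apply/negbTE/forallPn; exists y.
  by rewrite negb_imply ye mem_toggle lt_eqF.
Qed.

(** A toggle changes no other membership; so a witness [z] between [f] and [e]
    keeps its status, and whatever this is, it blocks one of the two toggles
    for good. *)
Lemma toggle_lt_far e f I :
  (f < e)%O -> ~ covers f e -> toggle e (toggle f I) = toggle f (toggle e I).
Proof.
move=> fe nfe.
have [z /andP[fz ze]] : exists z, (f < z)%O && (z < e)%O.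
  apply/existsP; apply: contraT => /existsPn nz; case: nfe; split=> // z [fz ze].
  by have := nz z; rewrite fz ze.
have blocked_f J : z \in val J -> toggle f J = J.
  move=> zJ; apply: ideal_eqP => x; rewrite mem_toggle.
  case: eqP => //= ->; rewrite (ideal_le (ltW fz) zJ).
  by apply/exists_inP; exists z.
have blocked_e J : z \notin val J -> toggle e J = J.
  move=> zJ; apply: ideal_eqP => x; rewrite mem_toggle.
  case: eqP => //= ->; have [eJ|_] := boolP (e \in val J).
    by rewrite (ideal_le (ltW ze) eJ) in zJ.
  by apply/negbTE/forallPn; exists z; rewrite negb_imply ze.
have [zI|zI] := boolP (z \in val I).
  by rewrite blocked_f // blocked_f // mem_toggle lt_eqF.
by rewrite !blocked_e // mem_toggle gt_eqF.
Qed.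

Lemma toggle_incomparable e f I :
  ~~ (e >=< f)%O -> toggle e (toggle f I) = toggle f (toggle e I).
Proof.
move=> ef; have ef' : e != f by apply: contraNneq ef => ->; apply: comparablexx.
have indep a b J : ~~ (a >=< b)%O -> a != b ->
    (a \in val (toggle a (toggle b J))) = (a \in val (toggle a J)).
  move=> ab ab'; rewrite !mem_toggle eqxx ab' /=.
  have nlt : ((a < b) = false)%O * ((b < a) = false)%O.
    by split; apply: contraNF ab => /ltW ab; rewrite /Order.comparable ab ?orbT.
  congr (if _ then _ else _).
    apply: eq_existsb => y; rewrite mem_toggle.
    by case: eqP => //= ->; rewrite nlt !andbF.
  apply: eq_forallb => y; rewrite mem_toggle.
  by case: eqP => //= ->; rewrite nlt.
apply: ideal_eqP => x; have [->|xe] := eqVneq x e.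
  by rewrite indep // [RHS]mem_toggle ef'.
have [->|xf] := eqVneq x f.
  by rewrite mem_toggle eq_sym ef' /= indep // 1?comparable_sym // eq_sym.
by rewrite !mem_toggle xe xf.
Qed.

(** Incomparable elements do not see each other at all; comparable ones without a
    cover have a third element strictly between them. *)
Lemma toggleC e f I : ~ covers e f -> ~ covers f e ->
  toggle e (toggle f I) = toggle f (toggle e I).
Proof.
move=> ef fe; case: (comparableP e f) => [lt_ef|lt_fe|ncmp|->] //.
- exact/esym/toggle_lt_far.
- exact: toggle_lt_far.
- exact: toggle_incomparable.
Qed.

End Toggles.

(** * Lattice projections *)

Section LatticeProjection.
Context {d : Order.disp_t} {P : finPOrderType d}.
Variables (n : nat) (rk : P -> int) (pi : P -> 'rV[int]_n) (v : 'rV[int]_n).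
Hypothesis hrk : rank_function rk.
Hypothesis hpi : lattice_projection rk pi.
Hypothesis hv : sign_vector v.

Let height (x : P) : int := dotp (pi x) v.

Lemma even_dotp x : (2 %| height x)%Z = (2 %| rk x)%Z.
Proof.
suff : (2 %| height x - rk x)%Z by lia.
rewrite -(proj2 hpi) -sumrB; apply: rpred_sum => j _.
by case: (hv j) => ->; rewrite unfold_in; lia.
Qed.

(** The coordinates of [pi y - pi x] are nonnegative with sum one, and signs
    cannot increase the absolute value of the sum. *)
Lemma covers_dotp x y : covers x y -> `|height y - height x| <= 1.
Proof.
move=> xy; have <- : rk y - rk x = 1 by rewrite (hrk xy) addrC addKr.
rewrite -!(proj2 hpi) /height /dotp -!sumrB.
apply: le_trans (ler_norm_sum _ _ _) _; apply: ler_sum => j _.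
have := proj1 hpi x y (ltW (proj1 xy)) j.
by case: (hv j) => ->; lia.
Qed.

Lemma toggleC_even x y I : (2 %| rk x)%Z = (2 %| rk y)%Z ->
  toggle x (toggle y I) = toggle y (toggle x I).
Proof. by move=> xy; apply: toggleC => /hrk; lia. Qed.

Definition hyperplane (i : int) : seq P :=
  [seq x <- index_enum P | height x == i].

Lemma hyperplane_act i : hyperplane_toggle pi v i =1 act toggle (hyperplane i).
Proof. by move=> I; rewrite /hyperplane_toggle -big_filter big_comp_act. Qed.

Lemma hyperplane_bij i : bijective (hyperplane_toggle pi v i).
Proof.
apply: (eq_bij (act_bij _ (fun x => inv_bij (toggleK x)))) => I.
by rewrite hyperplane_act.
Qed.

Lemma hyperplane_far i j I : far i j ->
  hyperplane_toggle pi v i (hyperplane_toggle pi v j I) =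
  hyperplane_toggle pi v j (hyperplane_toggle pi v i I).
Proof.
move=> ij; rewrite !hyperplane_act.
have comm x y J : height x = i -> height y = j ->
    toggle x (toggle y J) = toggle y (toggle x J).
  move=> xi yj; apply: toggleC => /covers_dotp; move: ij; rewrite /far; lia.
have comm1 x J : height x = i ->
    toggle x (act toggle (hyperplane j) J) =
      act toggle (hyperplane j) (toggle x J).
  move=> xi; have := filter_all (fun y => height y == j) (index_enum P).
  rewrite -/(hyperplane j); elim: (hyperplane j) => //= y s IH /andP[/eqP yj sj].
  by rewrite comm // IH.
have := filter_all (fun x => height x == i) (index_enum P).
rewrite -/(hyperplane i); elim: (hyperplane i) => //= x s IH /andP[/eqP xi si].
by rewrite IH // comm1.
Qed.

Lemma flatten_hyperplane (s : seq int) : uniq s ->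
  perm_eq (flatten [seq hyperplane i | i <- s])
          [seq x <- index_enum P | height x \in s].
Proof.
elim: s => [|i s IH] /=; first by rewrite filter_pred0.
case/andP=> is_ us; apply: (@perm_trans _ (hyperplane i ++
    [seq x <- index_enum P | height x \in s])); first by rewrite perm_cat2l IH.
rewrite uniq_perm ?filter_uniq ?index_enum_uniq //.
  rewrite cat_uniq !filter_uniq ?index_enum_uniq // andbT /=.
  apply/hasPn => x; rewrite !mem_filter => /andP[xs _].
  by apply: contra is_ => /andP[/eqP<-].
by move=> x; rewrite mem_cat !mem_filter mem_index_enum !andbT inE.
Qed.

Definition parity_part (b : bool) : seq P :=
  [seq x <- index_enum P | (2 %| rk x)%Z == b].

Definition gyration : order_ideal P -> order_ideal P :=
  act toggle (parity_part true ++ parity_part false).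

Lemma act_parity_part (b : bool) (s : seq int) :
    uniq s -> (forall x, height x \in s) ->
  act (hyperplane_toggle pi v) [seq i <- s | (2 %| i)%Z == b] =1
  act toggle (parity_part b).
Proof.
move=> us sP I; rewrite (eq_act _ hyperplane_act) act_flatten.
have st : perm_eq (flatten [seq hyperplane i | i <- s & (2 %| i)%Z == b])
                  (parity_part b).
  apply: perm_trans (flatten_hyperplane (filter_uniq _ us)) _.
  rewrite /parity_part (@eq_filter _ _ (fun x => (2 %| rk x)%Z == b)) // => x.
  by rewrite mem_filter sP andbT even_dotp.
apply: (act_perm _ st) => x y; rewrite !(perm_mem st) !mem_filter.
by move=> /andP[/eqP xb _] /andP[/eqP yb _] J; apply: toggleC_even; rewrite xb.
Qed.

(** The word of [Pro] is first extended by the heights outside the support,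
    whose toggles do nothing, so that every element of [P] is met. *)
Lemma Pro_gyration a b sigma :
    is_supp pi v a b -> interval_bijection a b sigma ->
  conjugate (Pro pi v a b sigma) gyration.
Proof.
case=> triv _ [sigma_in sigma_inj sigma_onto].
pose s0 := [seq sigma i | i <- int_range a b].
pose s1 := [seq i <- undup [seq height x | x : P] | i \notin `[a, b]].
have s0_in : {subset s0 <= `[a, b]}.
  by move=> _ /mapP[i ir ->]; apply: sigma_in; rewrite -mem_int_range.
have us : uniq (s0 ++ s1).
  rewrite cat_uniq filter_uniq ?undup_uniq // andbT; apply/andP; split.
    rewrite map_inj_in_uniq; last first.
      by move=> i j; rewrite !mem_int_range; apply: sigma_inj.
    rewrite /int_range; case: ifP => // _.
    by rewrite map_inj_uniq ?iota_uniq // => k l; lia.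
  apply/hasPn => i; rewrite mem_filter => /andP[iab _].
  by apply: contra iab; apply: s0_in.
have sP x : height x \in s0 ++ s1.
  rewrite mem_cat; case: (boolP (height x \in `[a, b])) => [/sigma_onto|] hx.
    by case: hx => i iab <-; rewrite map_f // mem_int_range.
  by rewrite mem_filter hx mem_undup image_f ?orbT.
pose T := hyperplane_toggle pi v.
have s1_id : act T s1 =1 id.
  have := filter_all (fun i => i \notin `[a, b]) (undup [seq height x | x : P]).
  rewrite -/s1 => s1_out I; elim: s1 s1_out {us sP} => //= i s IH /andP[iab sab].
  by rewrite IH //; apply: triv.
apply: (@conjugate_trans _ _ (act T (s0 ++ s1))).
  apply: eq_conjugate => I; rewrite act_cat s1_id /Pro big_comp_act.
  by rewrite /s0; elim: (int_range a b) => //= i s ->.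
pose e := [seq i <- s0 ++ s1 | (2 %| i)%Z == true].
pose o := [seq i <- s0 ++ s1 | (2 %| i)%Z == false].
apply: (@conjugate_trans _ _ (act T (e ++ o))).
  apply: (cyc_conjugate hyperplane_bij hyperplane_far); apply: perm_cyc => //.
  have -> : o = [seq i <- s0 ++ s1 | predC (fun i => (2 %| i)%Z == true) i].
    by apply: eq_filter => i /=; case: (2 %| i)%Z.
  by rewrite perm_sym; apply/permEl/perm_filterC.
by apply: eq_conjugate => I; rewrite /gyration !act_cat !act_parity_part.
Qed.

End LatticeProjection.

Theorem theorem3p26 (d : Order.disp_t) (P : finPOrderType d) (n : nat)
    (rk : P -> int) (pi : P -> 'rV[int]_n) (v w : 'rV[int]_n)
    (a b a' b' : int) (sigma tau : int -> int)
    (hrk : rank_function rk)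
    (hpi : lattice_projection rk pi)
    (hv : sign_vector v) (hw : sign_vector w)
    (hsuppv : is_supp pi v a b) (hsuppw : is_supp pi w a' b')
    (hsigma : interval_bijection a b sigma)
    (htau : interval_bijection a' b' tau) :
  exists phi : order_ideal P -> order_ideal P,
    bijective phi /\
    phi \o Pro pi v a b sigma =1 Pro pi w a' b' tau \o phi.
Proof.
apply: (conjugate_trans (Pro_gyration hrk hpi hv hsuppv hsigma)).
exact/conjugate_sym/(Pro_gyration hrk hpi hw hsuppw htau).
Qed.
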